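(* Let $d\in\mathbb{N}$ and let $K$ be a nonlinear factorizable power series kernel on $(-1,1)^d$, i.e. $K(x,y)=\prod_{k=1}^d\eta(x_ky_k)$ for $x,y\in(-1,1)^d$, where $\eta(z)=\sum_{n=0}^\infty c_nz^n$ is an analytic function with positive coefficients $c_n>0$. If $$\sum_{n=0}^\infty c_n^{1/2}<\infty,$$ then $K$ is the right-sided reproducing kernel of the right-sided reproducing kernel Banach space $\mathcal{B}_K^1((-1,1)^d)$ and the two-sided reproducing kernel of the two-sided reproducing kernel Banach space $\mathcal{B}_K^p((-1,1)^d)$ for $1<p\le\infty$. Moreover, $\mathcal{B}_K^p((-1,1)^d)\subseteq C((-1,1)^d)$ for $1\le p\le\infty$.
   Context: Let $\mathbb{N}_0=\{0,1,2,\dots\}$. For $n=(n_1,\dots,n_d)\in\mathbb{N}_0^d$ let $\phi_n(x):=\prod_{k=1}^dc_{n_k}^{1/2}x_k^{n_k}$, $x\in(-1,1)^d$. For $1\le p<\infty$, $\mathcal{B}_K^p((-1,1)^d):=\{f=\sum_{n\in\mathbb{N}_0^d}a_n\phi_n:(a_n)_{n\in\mathbb{N}_0^d}\in\ell_p\}$ with norm $(\sum_n|a_n|^p)^{1/p}$; and $\mathcal{B}_K^\infty((-1,1)^d):=\{f=\sum_{n\in\mathbb{N}_0^d}a_n\phi_n:(a_n)\in c_0\}$ with norm $\sup_n|a_n|$, where $c_0$ denotes the families tending to $0$. $C((-1,1)^d)$ is the set of continuous real functions on $(-1,1)^d$. Reproducing kernel Banach spaces (here with both domains equal to $\Omega=(-1,1)^d$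 with Lebesgue measure): $L_0(\Omega)$ denotes the real-valued measurable functions on $\Omega$ (genuine functions). Let $\mathcal{B}$ be a Banach space consisting of functions in $L_0(\Omega)$ whose continuous dual $\mathcal{B}'$ is isometrically isomorphic to a normed space $\mathcal{F}$ consisting of functions in $L_0(\Omega)$, identified with $\mathcal{B}'$; write $\langle f,G\rangle_{\mathcal{B}}:=G(f)$. $\mathcal{B}$ is right-sided with right-sided reproducing kernel $K$ if (i) $K(x,\cdot)\in\mathcal{F}\cong\mathcal{B}'$ for each $x\in\Omega$ and (ii) $\langle f,K(x,\cdot)\rangle_{\mathcal{B}}=f(x)$ for all $f\in\mathcal{B}$, $x\in\Omega$. It is two-sided with two-sided reproducing kernel $K$ if in addition (iii) $K(\cdot,y)\in\mathcal{B}$ for each $y\in\Omega$ and (iv) $\langle K(\cdot,y),g\rangle_{\mathcal{B}}=g(y)$ for all $g\in\mathcal{F}$, $y\in\Omega$. *)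

(* Defs.v *)
From HB Require Import structures.
From mathcomp Require Import all_boot all_order all_algebra finmap.
From mathcomp Require Import all_classical all_reals all_analysis.
From mathcomp.analysis.showcase Require summability.

Set Implicit Arguments.
Unset Strict Implicit.
Unset Printing Implicit Defensive.

Import Order.TTheory GRing.Theory Num.Theory.
Import numFieldNormedType.Exports.

Local Open Scope classical_set_scope.
Local Open Scope ring_scope.

(* Real-valued Borel functions on X: genuine functions, not classes modulo
   almost-everywhere equality. *)
Definition L0 (R : realType) (X : topologicalType) : set (X -> R) :=
  [set f | forall Y : set R, measurable Y -> <<s @open X >> (f @^-1` Y)].

(* A normed space consisting of functions of L0 is given by a normed module V
   with a linear injection ev sending each vector to the function it stands
   for; the function f belongs to the space when f is in [range ev]. *)
Definition function_space (R : realType) (X : topologicalType)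
    (V : normedModType R) (ev : {linear V -> (X -> R^o)}) : Prop :=
  injective ev /\ range ev `<=` @L0 R X.

Definition functional_norm (R : realType) (V : normedModType R)
    (G : V -> R^o) : R :=
  sup [set `|G v| | v in [set v : V | `|v| <= 1]].

(* Phi is an isometric isomorphism from F onto the continuous dual of B; the
   pairing <f, g>_B is then [Phi g f]. *)
Definition dual_isometry (R : realType) (B F : normedModType R)
    (Phi : {linear F -> (B -> R^o)}) : Prop :=
  [/\ forall g : F, linear (Phi g : B -> R^o) /\ continuous (Phi g : B -> R^o),
      forall g : F, functional_norm (Phi g) = `|g|
    & forall G : {linear B -> R^o}, continuous G -> exists g : F, Phi g = G].

Section Rkbs.
Variables (R : realType) (X : topologicalType).
Variables (B : completeNormedModType R) (evB : {linear B -> (X -> R^o)}).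
Variable K : X -> X -> R.

Definition right_sided_kernel (F : normedModType R)
    (evF : {linear F -> (X -> R^o)}) (Phi : {linear F -> (B -> R^o)}) : Prop :=
  (forall x : X, range evF (K x)) /\
  (forall (x : X) (g : F) (f : B), evF g = K x -> Phi g f = evB f x).

Definition left_sided_kernel (F : normedModType R)
    (evF : {linear F -> (X -> R^o)}) (Phi : {linear F -> (B -> R^o)}) : Prop :=
  (forall y : X, range evB (K ^~ y)) /\
  (forall (y : X) (f : B) (g : F), evB f = K ^~ y -> Phi g f = evF g y).

Definition right_sided_rkbs : Prop :=
  exists (F : normedModType R) (evF : {linear F -> (X -> R^o)})
         (Phi : {linear F -> (B -> R^o)}),
    [/\ function_space evB, function_space evF, dual_isometry Phi
      & right_sided_kernel evF Phi].

Definition two_sided_rkbs : Prop :=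
  exists (F : normedModType R) (evF : {linear F -> (X -> R^o)})
         (Phi : {linear F -> (B -> R^o)}),
    [/\ function_space evB, function_space evF, dual_isometry Phi,
        right_sided_kernel evF Phi & left_sided_kernel evF Phi].

End Rkbs.

(* At p = +oo this is c_0 (not l_infty), with the supremum norm.  The value at
   p = -oo is irrelevant: only 1 <= p is ever used. *)
Definition ell (R : realType) (I : choiceType) (p : \bar R) : set (I -> R) :=
  match p with
  | r%:E => [set a | (\esum_(i in [set: I]) (`|a i| `^ r)%:E < +oo)%E]
  | +oo%E => [set a | forall e : R, 0 < e -> finite_set [set i | e <= `|a i|]]
  | -oo%E => set0
  end.

Definition ell_norm (R : realType) (I : choiceType) (p : \bar R)
    (a : I -> R) : R :=
  match p with
  | r%:E => fine (\esum_(i in [set: I]) (`|a i| `^ r)%:E) `^ r^-1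
  | +oo%E => sup (range (fun i => `|a i|))
  | -oo%E => 0
  end.

Definition cube (R : realType) (d : nat) : set 'rV[R]_d :=
  [set x | forall k : 'I_d, -1 < x ord0 k < 1].
Arguments cube R d : clear implicits.

Definition multi_index (d : nat) : choiceType := {ffun 'I_d -> nat}.

(* K is the factorizable power series kernel of
   eta z = \sum_n c_n z^n, analytic on (-1, 1). *)
Definition nonlinear_power_series_kernel (R : realType) (d : nat)
    (c : nat -> R) (K : cube R d -> cube R d -> R) : Prop :=
  (forall n : nat, 0 < c n) /\
  exists eta : R -> R,
    (forall z : R, `|z| < 1 ->
       series (fun n => c n * z ^+ n) @ \oo --> eta z) /\
    (forall x y : cube R d,
       K x y = \prod_(k < d) eta (val x ord0 k * val y ord0 k)).

Definition phi (R : realType) (d : nat) (c : nat -> R) (n : multi_index d)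
    (x : cube R d) : R :=
  \prod_(k < d) (Num.sqrt (c (n k)) * val x ord0 k ^+ n k).

(* f = \sum_n a_n phi_n pointwise, as the limit of the finite partial sums
   directed by inclusion (no order on the multi-indices is involved). *)
Definition expansion (R : realType) (d : nat) (c : nat -> R)
    (a : multi_index d -> R) (f : cube R d -> R) : Prop :=
  forall x : cube R d,
    summability.partial_sum (fun n => a n * phi c n x)
      @ summability.totally --> f x.

Definition BK (R : realType) (d : nat) (c : nat -> R) (p : \bar R) :
    set (cube R d -> R) :=
  [set f | exists2 a, ell p a & expansion c a f].

(* (B, ev) is the space B_K^p with its norm.  Quantifying over every
   expansion makes well-definedness of that norm part of the claim. *)
Definition is_BK (R : realType) (d : nat) (c : nat -> R) (p : \bar R)
    (B : normedModType R) (ev : {linear B -> (cube R d -> R^o)}) : Prop :=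
  [/\ injective ev, range ev = @BK R d c p
    & forall (f : B) (a : multi_index d -> R),
        ell p a -> expansion c a (ev f) -> `|f| = ell_norm p a].

(* Main.v *)
Require Import Defs.
From HB Require Import structures.
From mathcomp Require Import all_boot all_order all_algebra finmap.
From mathcomp Require Import all_classical all_reals all_analysis.
From mathcomp Require Import ring lra zify.

Set Implicit Arguments.
Unset Strict Implicit.
Unset Printing Implicit Defensive.

Import Order.TTheory GRing.Theory Num.Theory.
Import numFieldNormedType.Exports.

Local Open Scope classical_set_scope.
Local Open Scope ring_scope.

(* The coefficient spaces l_p (c_0 at p = oo) are treated uniformly through the
   norms of their finite sections: Hoelder's inequality on finite index sets, and
   the fact that it is attained there, identify the dual of the sequences whose
   tails vanish in norm with all sequences of finite dual norm.  Since the
   weights \prod_k sqrt (c (n k)) are summable over the multi-indices, a bounded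
   family a gives an absolutely and uniformly convergent expansion
   \sum_n a_n phi_n, so every space involved consists of continuous functions.
   The coefficients are determined by the function (restrict to a curve
   x_k = t^(w_k) whose exponents isolate a single lowest-order term), and
   K x = \sum_n phi_n(x) phi_n has the summable coefficient family (phi_n x),
   so that the reproducing identities reduce to the definition of the pairing
   \sum_n a_n b_n. *)

#[local] Existing Instance summability.totally_filter.
Local Notation totally := summability.totally.
Local Notation partial_sum := summability.partial_sum.

(** * Unconditional sums *)

Section UnconditionalSums.
Variables (R : realType) (I : choiceType).
Implicit Types (f g u : I -> R) (A B : {fset I}).

(** On a divergent family [lim] is a mere default value, so each use rests on [abs_summable] or on a
    limit that is given. *)
Definition usum f : R := lim (partial_sum f @ totally).

Definition abs_summable f : Prop :=
  exists M : R, forall A, \sum_(i <- A) `|f i| <= M.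

Lemma partial_sumE f A : partial_sum f A = \sum_(i <- A) f i.
Proof. by rewrite /partial_sum big_seq_fsetE. Qed.

Lemma near_totally A : \forall B \near totally, (A `<=` B)%fset.
Proof. by exists A. Qed.

Lemma sum_fsetD f A B : (A `<=` B)%fset ->
  \sum_(i <- B) f i = \sum_(i <- A) f i + \sum_(i <- (B `\` A)%fset) f i.
Proof.
move=> /fsubsetP AB; rewrite (big_fsetID _ (mem A)) /=.
congr (_ + _); congr (bigop _ (enum_fset _) _); apply/fsetP => i; rewrite !inE /=.
  by rewrite andbC; case: (boolP (i \in A)) => // /AB ->.
by rewrite andbC.
Qed.

Lemma sum_fsetU f A B : [disjoint A & B]%fset ->
  \sum_(i <- (A `|` B)%fset) f i = \sum_(i <- A) f i + \sum_(i <- B) f i.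
Proof.
move=> AB; rewrite (sum_fsetD f (fsubsetUl A B)) fsetDUl fsetDv fset0U.
by move: AB; rewrite fdisjoint_sym => /fsetDidPl ->.
Qed.

Lemma fdisjointXD A B : [disjoint A & B `\` A]%fset.
Proof. by rewrite fdisjoint_sym; case/fsubsetDP: (fsubset_refl (B `\` A)%fset). Qed.

(** Take [A] whose sum is within [e] of the supremum of all finite sums: a finite set disjoint from
    [A] can then add at most [e]. *)
Lemma sum_tail u M : (forall i, 0 <= u i) ->
  (forall A, \sum_(i <- A) u i <= M) ->
  forall e, 0 < e ->
    exists A, forall B, [disjoint A & B]%fset -> \sum_(i <- B) u i <= e.
Proof.
move=> u0 uM e e0.
pose S := range (fun A => \sum_(i <- A) u i).
have hS : has_sup S.
  by split; [exists (\sum_(i <- fset0) u i), fset0|exists M => _ [A _ <-]].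
have [_ [A _ <-] hA] := sup_adherent e0 hS.
exists A => B AB.
have : \sum_(i <- (A `|` B)%fset) u i <= sup S.
  by apply: sup_upper_bound => //; exists (A `|` B)%fset.
by rewrite sum_fsetU // => ?; move: hA; lra.
Qed.

Lemma abs_summable_tail f : abs_summable f -> forall e, 0 < e ->
  exists A, forall B, [disjoint A & B]%fset -> \sum_(i <- B) `|f i| <= e.
Proof. by move=> [M fM]; apply: sum_tail fM. Qed.

Lemma abs_summable_bounded f : abs_summable f -> exists M, forall i, `|f i| <= M.
Proof.
by move=> [M fM]; exists M => i; have := fM [fset i]%fset; rewrite big_seq_fset1.
Qed.

Lemma abs_summable_le f g : (forall i, `|f i| <= `|g i|) ->
  abs_summable g -> abs_summable f.
Proof.
move=> fg [M gM]; exists M => A; apply: le_trans (gM A).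
exact: ler_sum.
Qed.

(** The net of partial sums is Cauchy: beyond the [A] of [abs_summable_tail], two partial sums
    differ only by terms outside [A]. *)
Lemma abs_summable_cvg f : abs_summable f -> cvg (partial_sum f @ totally).
Proof.
move=> sf; apply/cauchy_cvgP/cauchy_exP => e e0.
have [A hA] := abs_summable_tail sf (divr_gt0 e0 (ltr0n _ 2)).
exists (partial_sum f A), A => //= B /= AB.
rewrite -ball_normE /= !partial_sumE (sum_fsetD f AB) opprD addNKr normrN.
apply: le_lt_trans (ler_norm_sum _ _ _) _; apply: le_lt_trans (hA _ _) _.
  exact: fdisjointXD.
by rewrite ltr_pdivrMr ?ltr_pMr ?ltr1n.
Qed.

Lemma usum_cvg f : abs_summable f -> partial_sum f @ totally --> usum f.
Proof. exact: abs_summable_cvg. Qed.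

Lemma usum_unique f l : partial_sum f @ totally --> l -> usum f = l.
Proof. by move=> h; apply: cvg_lim h. Qed.

(** Eventually the partial sums run over supersets [B] of [A], so the bound on the part of [B]
    outside [A] passes to the limit. *)
Lemma usum_dist f A e : abs_summable f ->
  (forall B, [disjoint A & B]%fset -> `|\sum_(i <- B) f i| <= e) ->
  `|usum f - \sum_(i <- A) f i| <= e.
Proof.
move=> sf he.
have h : `|partial_sum f B - \sum_(i <- A) f i| @[B --> totally]
    --> `|usum f - \sum_(i <- A) f i|.
  by apply: cvg_norm; apply: cvgB; [exact: usum_cvg|exact: cvg_cst].
apply: (cvgr_to_le h); apply: filterS (near_totally A) => B AB.
rewrite partial_sumE (sum_fsetD f AB) addrAC subrr add0r.
exact/he/fdisjointXD.
Qed.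

Lemma usum_le f e : abs_summable f ->
  (forall A, `|\sum_(i <- A) f i| <= e) -> `|usum f| <= e.
Proof.
move=> sf he; have := @usum_dist f fset0 e sf (fun B _ => he B).
by rewrite big_seq_fset0 subr0.
Qed.

Lemma abs_summableZ k f : abs_summable f -> abs_summable (fun i => k * f i).
Proof.
move=> [M fM]; exists (`|k| * M) => A.
under eq_bigr do rewrite normrM.
by rewrite -mulr_sumr ler_wpM2l.
Qed.

Lemma usum_linear k f g : abs_summable f -> abs_summable g ->
  usum (fun i => k * f i + g i) = k * usum f + usum g.
Proof.
move=> sf sg; apply: usum_unique.
have -> : partial_sum (fun i => k * f i + g i) =
    (fun A => k * partial_sum f A + partial_sum g A).
  by apply/funext => A; rewrite !partial_sumE big_split /= mulr_sumr.
by apply: cvgD; [apply: cvgMr|]; exact: usum_cvg.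
Qed.

Lemma usum_fset f A : (forall i, i \notin A -> f i = 0) ->
  usum f = \sum_(i <- A) f i.
Proof.
move=> fA; apply: usum_unique; apply: cvg_near_cst.
apply: filterS (near_totally A) => B AB; rewrite partial_sumE (sum_fsetD f AB).
rewrite [X in _ + X]big1_seq ?addr0 // => i.
by rewrite inE => /andP[_ /andP[/fA]].
Qed.

End UnconditionalSums.

(** * Sequence spaces defined by norms of finite sections *)

(** The interface shared by all exponents. [snorm_mono] covers enlarging the index set and enlarging
    the entries at once; it ignores zero entries of [a], so it also handles truncations. In [snormZ]
    an inequality suffices, as equality follows by rescaling with the inverse. *)
Record section_norm (R : realType) (I : choiceType) := SectionNorm {
  snorm :> {fset I} -> (I -> R^o) -> R;
  snormD : forall A a b, snorm A (a + b) <= snorm A a + snorm A b;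
  snormZ : forall A k a, snorm A (k *: a) <= `|k| * snorm A a;
  snorm_mono : forall A B a b,
    (forall i, i \in A -> a i != 0 -> i \in B /\ `|a i : R| <= `|b i : R|) ->
    snorm A a <= snorm B b;
  snorm_coord : forall i a, `|a i : R| <= snorm [fset i]%fset a;
  snorm_sum : forall A a, snorm A a <= \sum_(i <- A) `|a i : R| }.

Section SectionNormTheory.
Variables (R : realType) (I : choiceType) (N : section_norm R I).
Implicit Types (A B : {fset I}) (a b : I -> R^o).

Lemma snorm0 A : N A 0 = 0.
Proof.
apply/eqP; rewrite eq_le; apply/andP; split.
  by apply: le_trans (snorm_sum _ _ _) _; rewrite big1 // => i _; rewrite normr0.
by rewrite -(lerDl (N A 0)) -[leLHS](congr1 (N A) (addr0 0)) snormD.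
Qed.

Lemma snormN A a : N A (- a) <= N A a.
Proof. by have := snormZ N A (-1) a; rewrite normrN1 mul1r scaleN1r. Qed.

Lemma snormB A a b : N A (a - b) <= N A a + N A b.
Proof. by apply: le_trans (snormD _ _ _ _) (lerD _ (snormN _ _)). Qed.

Lemma snorm_ge0 A a : 0 <= N A a.
Proof. by rewrite -(snorm0 A); apply: snorm_mono => i _; rewrite eqxx. Qed.

Definition trunc A a : I -> R^o := fun i => if i \in A then a i else 0.

Lemma snorm_trunc A B a : N B (trunc A a) <= N A a.
Proof. by apply: snorm_mono => i _; rewrite /trunc; case: ifP => // _; rewrite eqxx. Qed.

(* With [vanish] these are the sequences whose norm is order continuous, e.g.
   c_0 inside l_infty. *)
Definition lseq_pred (vanish : bool) : {pred I -> R^o} := fun a =>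
  `[< (exists M, forall A, N A a <= M) /\
      (vanish -> forall e, 0 < e ->
         exists A, forall B, [disjoint A & B]%fset -> N B a <= e) >].

Lemma lseq_predP (vanish : bool) a : reflect
  ((exists M, forall A, N A a <= M) /\
      (vanish -> forall e, 0 < e ->
         exists A, forall B, [disjoint A & B]%fset -> N B a <= e))
  (a \in lseq_pred vanish).
Proof. exact: asboolP. Qed.

Lemma lseq_submod_closed vanish : subsemimod_closed (lseq_pred vanish).
Proof.
have add : GRing.nmod_closed (lseq_pred vanish).
  split=> [|a b /lseq_predP[[M aM] av] /lseq_predP[[L bL] bv]].
    apply/lseq_predP; split; first by exists 0 => A; rewrite snorm0.
    by move=> _ e e0; exists fset0 => B _; rewrite snorm0 ltW.
  apply/lseq_predP; split.
    by exists (M + L) => A; apply: le_trans (snormD _ _ _ _) (lerD _ _).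
  move=> v e e0; have e2 : 0 < e / 2 by rewrite divr_gt0.
  have [A hA] := av v _ e2; have [B hB] := bv v _ e2.
  exists (A `|` B)%fset => C; rewrite fdisjointUX => /andP[AC BC].
  rewrite (splitr e); apply: le_trans (snormD _ _ _ _) (lerD _ _).
    exact: hA.
  exact: hB.
split=> // k a /lseq_predP[[M aM] av]; apply/lseq_predP; split.
  by exists (`|k| * M) => A; apply: le_trans (snormZ _ _ _ _) _; rewrite ler_wpM2l.
move=> v e e0; have k1 : 0 < `|k| + 1 by rewrite ltr_wpDl.
have [A hA] := av v _ (divr_gt0 e0 k1).
exists A => B AB; apply: le_trans (snormZ _ _ _ _) _.
apply: le_trans (_ : (`|k| + 1) * N B a <= _).
  by rewrite ler_wpM2r ?snorm_ge0 ?lerDl.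
by rewrite mulrC -ler_pdivlMr // hA.
Qed.

HB.instance Definition _ (vanish : bool) :=
  GRing.isSubmodClosed.Build R (I -> R^o) (lseq_pred vanish)
    (lseq_submod_closed vanish).
HB.instance Definition _ (vanish : bool) :=
  GRing.isOppClosed.Build (I -> R^o) (lseq_pred vanish)
    (fun (a : I -> R^o) => let: conj _ h := lseq_submod_closed vanish in
       fun ha => eq_ind _ (fun b => b \in lseq_pred vanish) (h (-1) a ha) _
         (scaleN1r a)).

Record lseq (vanish : bool) := Lseq {
  lseq_val :> I -> R^o;
  lseq_valP : lseq_val \in lseq_pred vanish }.

End SectionNormTheory.

(** * Norm and completeness of the sequence spaces *)

Section LseqSpace.
Variables (R : realType) (I : choiceType) (N : section_norm R I).
Variable vanish : bool.
Local Notation T := (lseq N vanish).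
Implicit Types (A B : {fset I}) (x y : T).

HB.instance Definition _ := [isSub for @lseq_val R I N vanish].
HB.instance Definition _ := [Choice of T by <:].
HB.instance Definition _ := [SubChoice_isSubLmodule of T by <:].

Definition lnorm x : R := sup (range (fun A => N A x)).

Lemma has_sup_lseq x : has_sup (range (fun A => N A x)).
Proof.
split; first by exists (N fset0 x), fset0.
have /lseq_predP[[M xM] _] := lseq_valP x.
by exists M => _ [A _ <-].
Qed.

Lemma snorm_le_lnorm x A : N A x <= lnorm x.
Proof. by apply: sup_upper_bound; [exact: has_sup_lseq|exists A]. Qed.

Lemma lnorm_le x M : (forall A, N A x <= M) -> lnorm x <= M.
Proof.
move=> h; apply: ge_sup; first by case: (has_sup_lseq x).
by move=> _ [A _ <-].
Qed.

Lemma lnorm_ge0 x : 0 <= lnorm x.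
Proof. exact: le_trans (snorm_ge0 N fset0 x) (snorm_le_lnorm x fset0). Qed.

Lemma coord_le_lnorm x i : `|x i| <= lnorm x.
Proof. exact: le_trans (snorm_coord N i x) (snorm_le_lnorm x _). Qed.

Lemma lseq_valB x y : lseq_val (x - y) = lseq_val x - lseq_val y.
Proof. exact: (raddfB (\val : T -> _)). Qed.

Lemma lseq_val_lincomb (J : choiceType) (A : {fset J}) (k : J -> R) (x : J -> T) i :
  lseq_val (\sum_(j <- A) k j *: x j) i = \sum_(j <- A) k j * x j i.
Proof.
rewrite -[LHS]/((\val : T -> _) _ i) (raddf_sum (\val : T -> _)) fct_sumE.
by [].
Qed.

Lemma lnormD x y : lnorm (x + y) <= lnorm x + lnorm y.
Proof.
apply: lnorm_le => A; apply: le_trans (snormD _ _ _ _) (lerD _ _);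
  exact: snorm_le_lnorm.
Qed.

Lemma lnormZ k x : lnorm (k *: x) = `|k| * lnorm x.
Proof.
have le l y : lnorm (l *: y) <= `|l| * lnorm y.
  apply: lnorm_le => A; apply: le_trans (snormZ _ _ _ _) _.
  by rewrite ler_wpM2l ?snorm_le_lnorm.
(* For [k != 0] the reverse inequality is [le] applied to the scalar [k^-1] and the vector
   [k *: x]. *)
apply/eqP; rewrite eq_le le /=.
have [->|k0] := eqVneq k 0; first by rewrite normr0 mul0r lnorm_ge0.
have := le k^-1 (k *: x); rewrite scalerA mulVf // scale1r normfV.
by rewrite mulrC ler_pdivlMr ?normr_gt0 // mulrC.
Qed.

Lemma lnorm0_eq0 x : lnorm x = 0 -> x = 0.
Proof.
move=> x0; apply/val_inj/funext => i; apply/eqP.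
by rewrite -normr_le0 -x0 coord_le_lnorm.
Qed.

HB.instance Definition _ :=
  @Lmodule_isNormed.Build R T lnorm lnormD lnormZ lnorm0_eq0.

(** A Cauchy filter converges coordinatewise to some [l]. On finite sections the norm is dominated
    by finitely many coordinates, so [l] is close to the filter uniformly over all sections, and it
    inherits boundedness and vanishing tails from a nearby member. *)
Lemma lseq_complete (F : set_system T) : ProperFilter F -> cauchy F -> cvg F.
Proof.
move=> FF /cauchyP Fc.
have Fex (e : R) : 0 < e -> exists x, F (fun y => `|x - y| < e).
  by move=> /Fc[x Fx]; exists x; apply: filterS Fx => y; rewrite -ball_normE.
have lim_coord i : exists l : R, ((x : T) i : R) @[x --> F] --> l.
  apply/cvg_ex/cauchy_cvgP/cauchy_exP => e e0.
  have [x Fx] := Fex e e0; exists (x i).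
  suff : F (fun y : T => ball (x i : R) e (y i)) by [].
  apply: filterS Fx => y /=; rewrite -ball_normE /=; apply: le_lt_trans.
  by rewrite -[x i - y i]/((lseq_val x - lseq_val y) i) -lseq_valB coord_le_lnorm.
have [l hl] := choice lim_coord.
have cvg_sum A : (\sum_(i <- A) `|(x : T) i - l i|) @[x --> F] --> (0 : R).
  elim: (enum_fset A) => [|i s IH].
    by under eq_cvg do rewrite big_nil; exact: cvg_cst.
  under eq_cvg do rewrite big_cons.
  have h : `|(x : T) i - l i| @[x --> F] --> `|l i - l i|.
    by apply: cvg_norm; apply: cvgB; [exact: hl|exact: cvg_cst].
  suff : `|(x : T) i - l i| + \sum_(j <- s) `|(x : T) j - l j| @[x --> F]
      --> `|l i - l i| + 0 by rewrite subrr normr0 addr0.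
  exact: cvgD.
(* The bound [e] is the same for all [A]: the auxiliary [y], close to [l] on [A] only, is allowed to
   depend on [A]. *)
have near_l (e : R) x : F (fun y => `|x - y| < e) ->
    forall A, N A (lseq_val x - l) <= e.
  move=> Fx A; apply/ler_addgt0Pr => d d0.
  have : \forall y \near F, \sum_(i <- A) `|(y : T) i - l i| <= d.
    exact: (cvgr_le _ (cvg_sum A)).
  move=> /(filterI Fx)/filter_ex[y [xy yd]].
  rewrite -(subrK (lseq_val y) (lseq_val x)) -addrA.
  apply: le_trans (snormD _ _ _ _) (lerD _ _).
    by rewrite -lseq_valB; exact: le_trans (snorm_le_lnorm _ A) (ltW xy).
  exact: le_trans (snorm_sum _ _ _) yd.
have lP : l \in lseq_pred N vanish.
  apply/lseq_predP; split.
    have [x Fx] := Fex 1 ltr01; exists (lnorm x + 1) => A.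
    rewrite -[l](subKr (lseq_val x)); apply: le_trans (snormB _ _ _ _) (lerD _ _).
      exact: snorm_le_lnorm.
    exact: near_l.
  move=> v e e0; have e2 : 0 < e / 2 by rewrite divr_gt0.
  have [x Fx] := Fex _ e2; have /lseq_predP[_ /(_ v _ e2)[A hA]] := lseq_valP x.
  exists A => B AB; rewrite (splitr e) -[l](subKr (lseq_val x)).
  by apply: le_trans (snormB _ _ _ _) (lerD _ _); [exact: hA|exact: near_l].
apply/cvg_ex; exists (Lseq lP); apply/cvgrPdist_le => e e0.
have e2 : 0 < e / 2 by rewrite divr_gt0.
have [x Fx] := Fex _ e2; near=> y.
rewrite -(subrK x (Lseq lP)) -addrA (splitr e).
apply: le_trans (ler_normD _ _) (lerD _ _).
  by rewrite distrC; apply: lnorm_le => A; rewrite lseq_valB; exact: near_l.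
by apply/ltW; near: y.
Unshelve. all: by end_near. Qed.

HB.instance Definition _ := Uniform_isComplete.Build T lseq_complete.

End LseqSpace.

(** * Truncation to finite index sets *)

Section Truncation.
Variables (R : realType) (I : choiceType) (N : section_norm R I).
Variable vanish : bool.
Implicit Types (A B : {fset I}) (a : I -> R^o).

Lemma trunc_in A a : trunc A a \in lseq_pred N vanish.
Proof.
apply/lseq_predP; split; first by exists (N A a) => B; exact: snorm_trunc.
move=> _ e e0; exists A => B /fdisjointP AB; apply: le_trans (ltW e0).
rewrite -(snorm0 N B); apply: snorm_mono => i iB; rewrite /trunc.
by case: ifP => [/AB|]; rewrite ?iB // eqxx.
Qed.

Definition ltrunc A a : lseq N vanish := Lseq (trunc_in A a).

Lemma norm_ltrunc A a : `|ltrunc A a| <= N A a.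
Proof. by apply: lnorm_le => B; exact: snorm_trunc. Qed.

End Truncation.

(** The error is [f] off [A], so its section over [B] is bounded by the section of [f] over the part
    of [B] outside [A]. Vanishing tails make this small. *)
Lemma ltrunc_cvg (R : realType) (I : choiceType) (N : section_norm R I)
    (f : lseq N true) : ltrunc N true A f @[A --> totally] --> f.
Proof.
apply/cvgrPdist_le => e e0.
have /lseq_predP[_ /(_ isT e e0)[A0 hA0]] := lseq_valP f.
apply: filterS (near_totally A0) => A A0A; apply: lnorm_le => B.
rewrite lseq_valB; apply: le_trans (hA0 (B `\` A)%fset _); last first.
  exact: fdisjointWl A0A (fdisjointXD _ _).
apply: snorm_mono => i iB; rewrite !inE iB andbT /= /trunc.
rewrite !fctE /=; case: ifP => iA; first by rewrite subrr eqxx.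
by rewrite subr0.
Qed.

(** * Duality *)

Section Pairing.
Variables (R : realType) (I : choiceType) (N N' : section_norm R I).
Hypothesis hoelder_section : forall (A : {fset I}) (a b : I -> R^o),
  \sum_(i <- A) `|a i * b i| <= N A a * N' A b.
Local Notation B := (lseq N true).
Local Notation F := (lseq N' false).

Lemma pairing_section_le (f : B) (g : F) (A : {fset I}) :
  \sum_(i <- A) `|f i * g i| <= `|f| * `|g|.
Proof.
apply: le_trans (hoelder_section A f g) _.
by apply: ler_pM; rewrite ?snorm_ge0 //; exact: snorm_le_lnorm.
Qed.

Lemma pairing_summable (f : B) (g : F) : abs_summable (fun i => f i * g i).
Proof. by exists (`|f| * `|g|); exact: pairing_section_le. Qed.

Definition pairing (g : F) : B -> R^o := fun f => usum (fun i => f i * g i).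

Lemma pairing_linear g : linear (pairing g).
Proof.
move=> k f1 f2; rewrite /pairing -[RHS]/(k * usum _ + usum _) -usum_linear;
  try exact: pairing_summable.
by congr usum; apply/funext => i /=; rewrite mulrA -mulrDl.
Qed.

Lemma pairing_linearl : linear pairing.
Proof.
move=> k g1 g2; apply/funext => f.
rewrite /pairing -[RHS]/(k * usum _ + usum _) -usum_linear; try exact: pairing_summable.
congr usum; apply/funext => i /=; rewrite mulrCA -mulrDr.
by [].
Qed.

HB.instance Definition _ g := GRing.isLinear.Build R B R^o *:%R (pairing g)
  (pairing_linear g).
(* A separate head constant: [pairing] is already the key of the instance for
   [pairing g]. *)
Definition duality : F -> (B -> R^o) := pairing.

HB.instance Definition _ := GRing.isLinear.Build R F (B -> R^o) *:%R duality
  pairing_linearl.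

Lemma pairing_le g f : `|pairing g f| <= `|g| * `|f|.
Proof.
rewrite mulrC; apply: usum_le; first exact: pairing_summable.
by move=> A; apply: le_trans (ler_norm_sum _ _ _) (pairing_section_le _ _ _).
Qed.

Lemma pairing_continuous g : continuous (pairing g).
Proof.
apply: bounded_linear_continuous; apply/linear_boundedP.
near=> r => f; apply: le_trans (pairing_le g f) _.
by apply: ler_wpM2r => //; near: r; exact: nbhs_pinfty_ge.
Unshelve. all: by end_near. Qed.

Lemma pairing_ltrunc g (A : {fset I}) (a : I -> R^o) :
  pairing g (ltrunc N true A a) = \sum_(i <- A) a i * g i.
Proof.
rewrite /pairing (usum_fset (A := A)) /= => [|i /negPf iA]; last first.
  by rewrite /trunc iA mul0r.
by apply: eq_big_seq => i iA; rewrite /trunc iA.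
Qed.

Hypothesis hoelder_attained : forall (A : {fset I}) (b : I -> R^o),
  exists2 a : I -> R^o, N A a <= 1 & \sum_(i <- A) a i * b i = N' A b.

(** One inequality is Hoelder's. For the other, the extremal [a] on [A], cut off outside [A], lies
    in the unit ball and pairs with [g] to exactly [N' A g]. *)
Lemma pairing_functional_norm g : functional_norm (pairing g) = `|g|.
Proof.
have ub : ubound [set `|pairing g f| | f in [set f : B | `|f| <= 1]] `|g|.
  move=> _ [f /= f1 <-]; apply: le_trans (pairing_le g f) _.
  by rewrite -[leRHS]mulr1 ler_wpM2l.
apply/eqP; rewrite eq_le; apply/andP; split.
  by apply: ge_sup => //; exists `|pairing g 0|, 0 => //=; rewrite normr0.
apply: lnorm_le => A; have [a a1 <-] := hoelder_attained A g.
apply: le_trans (ler_norm _) _; rewrite -pairing_ltrunc.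
apply: sup_upper_bound.
  split; last by exists `|g|.
  by exists `|pairing g 0|, 0 => //=; rewrite normr0.
by exists (ltrunc N true A a) => //=; exact: le_trans (norm_ltrunc _ _ _ _) a1.
Qed.

(** Let [b] collect the values of [G] on the unit vectors. Extremal vectors on [A] turn [N' A b]
    into a value of [G] on the unit ball, which bounds it by [M] for every [A]. Density of the
    truncations then identifies [G] with the pairing against [b]. *)
Lemma pairing_onto (G : {linear B -> R^o}) : continuous G ->
  exists g : F, pairing g = G.
Proof.
move=> Gc; pose e i : I -> R^o := fun j => (i == j)%:R.
pose b : I -> R^o := fun i => G (ltrunc N true [fset i]%fset (e i)).
have Gtrunc A a : G (ltrunc N true A a) = \sum_(i <- A) a i * b i.
  rewrite /b -[RHS](_ : G (\sum_(i <- A) a i *: ltrunc N true [fset i]%fset (e i)) = _).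
    congr (G _); apply/val_inj/funext => j /=.
    rewrite lseq_val_lincomb /= /trunc.
    under eq_bigr => i _.
      rewrite /trunc inE /e (_ : _ * _ = if i == j then a j else 0); last first.
        by rewrite eq_sym; case: eqP => [->|_]; rewrite ?eqxx ?mulr1 ?mulr0.
      over.
    case: ifP => jA.
      rewrite (big_fsetD1 j) //= eqxx big1_fset ?addr0 // => i.
      by rewrite !inE => /andP[/negPf ->].
    rewrite big1_fset // => i iA _; case: eqP => // ij.
    by rewrite -ij iA in jA.
  by rewrite linear_sum; apply: eq_bigr => i _; rewrite linearZ.
have [M M0 GM] : exists2 M, 0 < M & forall f, `|G f| <= M * `|f|.
  have /linear_boundedP := (linear_bounded_continuous G).2 Gc.
  by move=> /pinfty_ex_gt0[M M0 h]; exists M.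
have bP : b \in lseq_pred N' false.
  apply/lseq_predP; split=> //; exists M => A.
  have [a a1 <-] := hoelder_attained A b.
  rewrite -Gtrunc; apply: le_trans (ler_norm _) _; apply: le_trans (GM _) _.
  rewrite -[leRHS]mulr1 ler_pM2l //.
  exact: le_trans (norm_ltrunc _ _ _ _) a1.
exists (Lseq bP); apply/funext => f; apply: usum_unique.
have -> : partial_sum (fun i => f i * (Lseq bP : F) i) =
    (fun A => G (ltrunc N true A f)).
  by apply/funext => A; rewrite partial_sumE Gtrunc.
exact: (cvg_comp _ _ (@ltrunc_cvg _ _ N f) (Gc f)).
Qed.

Lemma lseq_dual : exists Phi : {linear F -> (B -> R^o)},
  dual_isometry Phi /\ forall g f, Phi g f = usum (fun i => f i * g i).
Proof.
exists (duality : {linear F -> (B -> R^o)}); split=> //.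
split; [|exact: pairing_functional_norm|exact: pairing_onto].
by move=> g; split; [exact: pairing_linear|exact: pairing_continuous].
Qed.

End Pairing.

(** * Finite-dimensional l_p norms *)

Section LpSections.
Variables (R : realType) (I : choiceType).
Implicit Types (A B : {fset I}) (a b : I -> R) (p q : \bar R) (r s : R).

(** Both sums are extended by zero to the union of the index sets and compared there term by
    term. *)
Lemma ler_sum_fset A B (u v : I -> R) : (forall i, 0 <= v i) ->
  (forall i, i \in A -> u i != 0 -> i \in B /\ u i <= v i) ->
  \sum_(i <- A) u i <= \sum_(i <- B) v i.
Proof.
move=> v0 uv; have cond (D : {fset I}) (w : I -> R) : (D `<=` A `|` B)%fset ->
    \sum_(i <- D) w i = \sum_(i <- (A `|` B)%fset) (if i \in D then w i else 0).
  move=> /(sum_fsetD _) ->; rewrite [X in _ + X]big1_fset ?addr0 => [|i].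
    by apply: eq_big_seq => i ->.
  by rewrite inE => /andP[/negPf ->].
rewrite (cond A) ?fsubsetUl // (cond B) ?fsubsetUr //.
apply: ler_sum => i _; case: ifP => iA; last by case: ifP.
have [->|ui] := eqVneq (u i) 0; first by case: ifP.
by have [-> ?] := uv _ iA ui.
Qed.

Definition lp_section p A a : R :=
  match p with
  | r%:E => (\sum_(i <- A) `|a i| `^ r) `^ r^-1
  | +oo%E => \big[Num.max/0]_(i <- A) `|a i|
  | -oo%E => 0
  end.

(** In the finite case the equation forces both exponents above [1]; the pairs formed by [1] and
    [+oo] are listed separately. *)
Definition conjugate_exponents p q : Prop :=
  match p, q with
  | r%:E, s%:E => [/\ 0 < r, 0 < s & r^-1 + s^-1 = 1]
  | r%:E, +oo%E => r = 1
  | +oo%E, s%:E => s = 1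
  | _, _ => False
  end.

Lemma conjugate_sym p q : conjugate_exponents p q -> conjugate_exponents q p.
Proof. by case: p q => [r||] [s||] //= [? ? ?]; split=> //; rewrite addrC. Qed.

Lemma conjugate_exists p : (1 <= p)%E -> exists q, conjugate_exponents p q.
Proof.
case: p => [r|_|]; [|by exists 1%E|by rewrite leeNy_eq].
rewrite lee_fin le_eqVlt => /predU1P[<-|r1]; first by exists +oo%E.
have r0 : 0 < r by exact: lt_trans r1.
exists ((1 - r^-1)^-1)%:E => /=; rewrite invrK; split=> //; last by rewrite subrKC.
by rewrite invr_gt0 subr_gt0 invf_lt1.
Qed.

Lemma sum_powR_ge0 r A a : 0 <= \sum_(i <- A) `|a i| `^ r.
Proof. by apply: sumr_ge0 => i _; exact: powR_ge0. Qed.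

Lemma lp_section1 A a : lp_section 1%E A a = \sum_(i <- A) `|a i|.
Proof.
rewrite /lp_section invr1 powRr1 ?sum_powR_ge0 //.
by apply: eq_bigr => i _; rewrite powRr1.
Qed.

Lemma lp_section_ge0 p A a : 0 <= lp_section p A a.
Proof.
case: p => [r||] //=; first exact: powR_ge0.
exact: bigmax_ge_id.
Qed.

Lemma lp_section_mono p A B a b : (0 < p)%E ->
  (forall i, i \in A -> a i != 0 -> i \in B /\ `|a i| <= `|b i|) ->
  lp_section p A a <= lp_section p B b.
Proof.
move=> + ab; case: p => [r||]; last by rewrite ltNge leNye.
  rewrite lte_fin => r0; rewrite /lp_section.
  apply: ge0_ler_powR; rewrite ?nnegrE ?sum_powR_ge0 ?invr_ge0 ?(ltW r0) //.
  apply: (@ler_sum_fset A B (fun i => `|a i| `^ r) (fun i => `|b i| `^ r)) => [i|i iA].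
    exact: powR_ge0.
  rewrite powR_eq0 normr_eq0 negb_and (gt_eqF r0) orbF => /(ab _ iA)[-> ?].
  by split=> //; apply: ge0_ler_powR; rewrite ?nnegrE // (ltW r0).
move=> _; rewrite /lp_section big_seq; apply: bigmax_le => [|i iA].
  exact: bigmax_ge_id.
have [->|ai] := eqVneq (a i) 0; first by rewrite normr0 bigmax_ge_id.
by have [iB ?] := ab _ iA ai; apply: bigmax_sup_seq iB _ _.
Qed.

Lemma lp_section_fset1 p i a : (0 < p)%E -> lp_section p [fset i]%fset a = `|a i|.
Proof.
case: p => [r||]; last by rewrite ltNge leNye.
  by rewrite lte_fin /= => r0; rewrite big_seq_fset1 -powRrM mulfV ?powRr1 // gt_eqF.
move=> _; apply/eqP; rewrite eq_le; apply/andP; split; rewrite /lp_section.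
  by rewrite big_seq; apply: bigmax_le => // j; rewrite inE => /eqP ->.
have ii : i \in [fset i]%fset by rewrite inE.
exact: bigmax_sup_seq ii _ _.
Qed.

Lemma lp_section_coord p A i a : (0 < p)%E -> i \in A ->
  `|a i| <= lp_section p A a.
Proof.
move=> p0 iA; rewrite -(lp_section_fset1 i a p0); apply: lp_section_mono => // j.
by rewrite inE => /eqP ->.
Qed.

Lemma conjugate_gt0 p q : conjugate_exponents p q -> (0 < p)%E.
Proof. by case: p q => [r||] [s||] //= => [[]|->]. Qed.

Lemma sum_normalized r A a : 0 < r -> 0 < lp_section r%:E A a ->
  \sum_(i <- A) (`|a i| / lp_section r%:E A a) `^ r = 1.
Proof.
move=> r0 a0; under eq_bigr => i _.
  rewrite powRM ?invr_ge0 ?(ltW a0) // -powR_inv1 ?(ltW a0) // -powRrM mulN1r powRN.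
  over.
rewrite -mulr_suml -[X in X / _](_ : lp_section r%:E A a `^ r = _).
  by rewrite mulfV // powR_eq0 gt_eqF.
by rewrite /= -powRrM mulVf ?gt_eqF // powRr1 ?sum_powR_ge0.
Qed.

Lemma conjugate_ge1 p q : conjugate_exponents p q -> (1 <= q)%E.
Proof.
case: p q => [r||] [s||] //= => [[r0 s0 rs]|_|->//]; last by rewrite leey.
by rewrite lee_fin -[leRHS]invrK invf_ge1 ?invr_gt0 // -rs lerDr invr_ge0 ltW.
Qed.

(** For the pairs [1], [+oo] each factor is bounded by the maximum. Otherwise both families are
    normalized and Young's inequality [conjugate_powR] is summed, the right-hand sides adding up to
    [r^-1 + s^-1 = 1]. *)
Lemma lp_hoelder p q A a b : conjugate_exponents p q ->
  \sum_(i <- A) `|a i * b i| <= lp_section p A a * lp_section q A b.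
Proof.
have bounded u v : \sum_(i <- A) `|u i * v i| <=
    lp_section 1%E A u * lp_section +oo%E A v.
  rewrite lp_section1 mulr_suml !big_seq; apply: ler_sum => i iA.
  by rewrite normrM ler_wpM2l // lp_section_coord.
case: p q => [r||] [s||] pq; try (exfalso; exact: pq); last 2 first.
- by rewrite [r]pq; exact: bounded.
- rewrite [s]pq mulrC; under eq_bigr do rewrite mulrC.
  exact: bounded.
have [r0 s0 rs] := pq.
(* A vanishing section norm kills every coordinate on [A]; past this case one may divide by both
   norms. *)
have zero (p : \bar R) u v : (0 < p)%E -> lp_section p A u = 0 ->
    \sum_(i <- A) `|u i * v i| = 0.
  move=> p0 u0; rewrite big_seq big1 // => i iA.
  have := lp_section_coord u p0 iA; rewrite u0 normr_le0 => /eqP ->.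
  by rewrite mul0r normr0.
have [a0|a0] := eqVneq (lp_section r%:E A a) 0; first by rewrite (zero r%:E) // a0 mul0r.
have [b0|b0] := eqVneq (lp_section s%:E A b) 0.
  by under eq_bigr do rewrite mulrC; rewrite (zero s%:E) // b0 mulr0.
have Na : 0 < lp_section r%:E A a by rewrite lt_def a0 lp_section_ge0.
have Nb : 0 < lp_section s%:E A b by rewrite lt_def b0 lp_section_ge0.
move: Na Nb (sum_normalized r0 Na) (sum_normalized s0 Nb) => {a0 b0}.
move: (lp_section r%:E A a) (lp_section s%:E A b) => M L M0 L0 sumM sumL.
have ML0 : 0 < M * L by exact: mulr_gt0.
rewrite -[leRHS]mul1r -(ler_pdivrMr _ _ ML0) mulr_suml.
apply: le_trans (_ : \sum_(i <- A)
    ((`|a i| / M) `^ r / r + (`|b i| / L) `^ s / s) <= _).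
  apply: ler_sum => i _; apply: le_trans (conjugate_powR _ _ r0 s0 rs);
    rewrite ?divr_ge0 ?(ltW M0) ?(ltW L0) //.
  by rewrite normrM invfM mulrACA.
by rewrite big_split -!mulr_suml /= sumM sumL !mul1r rs.
Qed.

(** The extremal vector carries the signs of [b]: with sizes given by the power [s - 1] for finite
    exponents, concentrated at a largest entry when [q] is [+oo], and of modulus at most [1]
    everywhere when [p] is [+oo]. *)
Lemma lp_attained p q A b : conjugate_exponents p q ->
  exists2 a, lp_section p A a <= 1 & \sum_(i <- A) a i * b i = lp_section q A b.
Proof.
case: p q => [r||] [s||] pq; try (exfalso; exact: pq).
- have [r0 s0 rs] := pq.
  have [Mz|Mnz] := eqVneq (lp_section s%:E A b) 0.
    exists (fun=> 0); last by rewrite Mz big1 // => i _; rewrite mul0r.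
    rewrite /= big1 ?powR0 ?invr_eq0 ?gt_eqF // => i _.
    by rewrite normr0 powR0 ?gt_eqF.
  have M0 : 0 < lp_section s%:E A b by rewrite lt_def Mnz lp_section_ge0.
  (* This identity makes the [r]-th powers of the extremal vector equal to the normalized [s]-th
     powers of [b] wherever [b] is nonzero. *)
  have rs' : (s - 1) * r = s.
    have r0' : r != 0 by rewrite gt_eqF.
    have s0' : s != 0 by rewrite gt_eqF.
    have : r + s = r * s.
      by rewrite -[RHS]mulr1 -rs mulrDr mulrAC mulfV // mul1r mulfK // addrC.
    by rewrite mulrBl mul1r (mulrC s) => <-; rewrite addrAC subrr add0r.
  have normalized := sum_normalized s0 M0.
  move: (lp_section s%:E A b) Mnz M0 normalized => M Mnz M0 normalized.
  exists (fun i => Num.sg (b i) * (`|b i| / M) `^ (s - 1)).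
    suff : \sum_(i <- A) `|Num.sg (b i) * (`|b i| / M) `^ (s - 1)| `^ r <= 1.
      move=> /(ge0_ler_powR (ltW (_ : 0 < r^-1))) /=.
      by rewrite powR1; apply; rewrite ?invr_gt0 ?nnegrE // sum_powR_ge0.
    rewrite -[leRHS]normalized; apply: ler_sum => i _.
    rewrite -[in leRHS]rs' powRrM; apply: ge0_ler_powR; rewrite ?nnegrE ?(ltW r0) ?powR_ge0 //.
    rewrite normrM (ger0_norm (powR_ge0 _ _)) normr_sg.
    by rewrite -[leRHS]mul1r ler_wpM2r ?powR_ge0 // lern1 leq_b1.
  rewrite -[RHS]mulr1 -[X in _ = _ * X]normalized mulr_sumr; apply: eq_bigr => i _.
  rewrite -(mulr_powRB1 (_ : 0 <= `|b i| / M) s0) ?divr_ge0 ?(ltW M0) //.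
  by rewrite [in RHS]mulrA [M * _]mulrCA mulfV // mulr1 mulrAC -normrEsg.
- rewrite /= in pq; rewrite pq.
  (* An empty [A] has no maximizing index; the maximum then takes its default value [0]. *)
  have [->|[i0 i0A]] := fset_0Vmem A.
    exists (fun=> 0); first by rewrite lp_section1 big_seq_fset0.
    apply/esym/eqP; rewrite big_seq_fset0 eq_le lp_section_ge0 andbT.
    by rewrite /lp_section big_seq; apply: bigmax_le => // i; rewrite inE.
  have [i iA bi] : exists2 i, i \in A & lp_section +oo%E A b = `|b i|.
    pose m := [arg max_(i > [` i0A]%fset : A) `|b (val i)|]%O.
    exists (val m); first exact: valP.
    apply/eqP; rewrite eq_le; apply/andP; split; last exact: lp_section_coord (valP m).
    rewrite /lp_section big_seq; apply: bigmax_le => // i iA.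
    rewrite /m; case: Order.TotalTheory.arg_maxP => // j _ jmax.
    exact: (jmax [` iA]%fset isT).
  exists (fun j => if j == i then Num.sg (b i) else 0).
    rewrite lp_section1 (big_fsetD1 i) //= eqxx big1_fset ?addr0 => [|j].
      by rewrite normr_sg lern1 leq_b1.
    by rewrite !inE => /andP[/negPf -> _]; rewrite normr0.
  rewrite bi (big_fsetD1 i) //= eqxx big1_fset ?addr0 => [|j].
    by rewrite -normrEsg.
  by rewrite !inE => /andP[/negPf -> _]; rewrite mul0r.
- rewrite /= in pq; rewrite pq lp_section1; exists (fun i => Num.sg (b i)).
    apply: bigmax_le => // i _.
    by rewrite normr_sg lern1 leq_b1.
  by apply: eq_bigr => i _; rewrite -normrEsg.
Qed.

End LpSections.

(** * The section norm of an exponent [p] with [1 <= p] *)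

Section LpNorm.
Variables (R : realType) (I : choiceType) (p : \bar R) (p1 : (1 <= p)%E).
Implicit Types (A B : {fset I}) (a b : I -> R^o).

Let p_gt0 : (0 < p)%E. Proof. exact: lt_le_trans p1. Qed.

(* The triangle inequality and homogeneity come from duality: [lp_section p A a]
   is a value [\sum_(i <- A) b i * a i] with [b] in the unit ball of the
   conjugate exponent. *)
Lemma lp_dual_witness A a : exists2 b : I -> R,
  (forall a', \sum_(i <- A) `|b i * a' i : R| <= lp_section p A a') &
  lp_section p A a = \sum_(i <- A) b i * a i /\ forall i, i \in A -> `|b i| <= 1.
Proof.
have [q pq] := conjugate_exists p1; have qp := conjugate_sym pq.
have [b b1 ba] := lp_attained A a qp; exists b => [a'|]; last first.
  split=> [|i iA]; first by rewrite -ba.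
  exact: le_trans (lp_section_coord _ (conjugate_gt0 qp) iA) b1.
apply: le_trans (lp_hoelder A b a' qp) _.
by rewrite -[leRHS]mul1r ler_wpM2r ?lp_section_ge0.
Qed.

Lemma lp_sectionD A a b :
  lp_section p A (a + b) <= lp_section p A a + lp_section p A b.
Proof.
have [c hc [-> _]] := lp_dual_witness A (a + b).
apply: le_trans (lerD (hc a) (hc b)); rewrite -big_split /=.
by apply: ler_sum => i _; rewrite mulrDr lerD // ler_norm.
Qed.

Lemma lp_sectionZ A k a : lp_section p A (k *: a) <= `|k| * lp_section p A a.
Proof.
have [c hc [-> _]] := lp_dual_witness A (k *: a).
apply: le_trans (ler_wpM2l (normr_ge0 k) (hc a)).
rewrite mulr_sumr; apply: ler_sum => i _.
by rewrite -normrM mulrCA ler_norm.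
Qed.

Lemma lp_section_sum A a : lp_section p A a <= \sum_(i <- A) `|a i : R|.
Proof.
have [c _ [-> c1]] := lp_dual_witness A a.
rewrite !big_seq; apply: ler_sum => i iA; apply: le_trans (ler_norm _) _.
by rewrite normrM -[leRHS]mul1r ler_wpM2r // c1.
Qed.

Definition lp_norm : section_norm R I :=
  @SectionNorm R I (lp_section p) lp_sectionD lp_sectionZ
    (fun A B a b => @lp_section_mono R I p A B a b p_gt0)
    (fun i a => eq_ind_r (fun x => `|a i : R| <= x) (lexx _)
       (lp_section_fset1 i a p_gt0))
    lp_section_sum.

End LpNorm.

(** * Identification with [ell] and [ell_norm] *)

Section EllSpaces.
Variables (R : realType) (I : choiceType).
Implicit Types (A B : {fset I}) (a : I -> R^o) (u : I -> R).

Lemma sum_le_esum A u : (forall i, 0 <= u i) ->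
  ((\sum_(i <- A) u i)%:E <= \esum_(i in [set: I]) (u i)%:E)%E.
Proof.
move=> u0; apply: esum_ge; exists [set` A]; first by split=> //; exact: finite_fset.
by rewrite fsbig_finite ?finite_fset //= set_fsetK sumEFin.
Qed.

Lemma esum_le_sum u M : (forall A, \sum_(i <- A) u i <= M) ->
  (\esum_(i in [set: I]) (u i)%:E <= M%:E)%E.
Proof.
move=> uM; apply: ge_ereal_sup => _ [A [finA _] <-].
by rewrite fsbig_finite //= sumEFin lee_fin.
Qed.

Lemma lp_section_powR r A a : 0 < r ->
  lp_section r%:E A a `^ r = \sum_(i <- A) `|a i : R| `^ r.
Proof.
by move=> r0; rewrite /= -powRrM mulVf ?gt_eqF // powRr1 ?sum_powR_ge0.
Qed.

(** For finite [p] the tails vanish automatically, being controlled by a summable family of [r]-th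
    powers. At [+oo] vanishing tails in the maximum norm say that only finitely many entries reach
    any given [e], which is [c_0]. *)
Lemma ell_lseq p (p1 : (1 <= p)%E) a : ell p a <-> a \in lseq_pred (lp_norm I p1) true.
Proof.
split=> [|/lseq_predP[]]; case: p p1 => [r||] p1 //.
- rewrite /ell /= => afin; apply/lseq_predP.
  have r0 : 0 < r by rewrite -lte_fin; exact: (lt_le_trans _ p1).
  have aM A : \sum_(i <- A) `|a i : R| `^ r <=
      fine (\esum_(i in [set: I]) (`|a i : R| `^ r)%:E).
    rewrite -lee_fin fineK; first by apply: sum_le_esum => i; exact: powR_ge0.
    by rewrite ge0_fin_numE // esum_ge0 // => i _; rewrite lee_fin powR_ge0.
  split=> [|_ e e0].
    exists (fine (\esum_(i in [set: I]) (`|a i : R| `^ r)%:E) `^ r^-1) => A /=.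
    by apply: ge0_ler_powR; rewrite ?nnegrE ?invr_ge0 ?(ltW r0) ?(le_trans _ (aM A)) ?sum_powR_ge0.
  have [A hA] := sum_tail (fun i => powR_ge0 `|a i : R| r) aM (powR_gt0 r e0).
  exists A => B AB; rewrite -[leRHS](powRr1 (ltW e0)) -(mulfV (lt0r_neq0 r0)) powRrM.
  apply: ge0_ler_powR; rewrite ?nnegrE ?invr_ge0 ?(ltW r0) ?powR_ge0 ?sum_powR_ge0 //.
  exact: hA.
- rewrite /ell => afin; apply/lseq_predP; split.
    (* Only finitely many entries reach [1]; the maximum over them, or [1] itself, bounds the
       family. *)
    pose A := fset_set [set i | 1 <= `|a i : R|].
    exists (Num.max 1 (lp_section +oo%E A a)) => B.
    apply: bigmax_le => [|i _]; first by rewrite le_max ler01.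
    rewrite le_max; case: (leP `|a i : R| 1) => //= ai.
    apply: (@lp_section_coord R I +oo%E A i a) => //.
    by rewrite in_fset_set ?inE /= ?(ltW ai) //; exact: afin.
  move=> _ e e0; exists (fset_set [set i | e <= `|a i : R|]) => B /fdisjointP AB.
  rewrite /= /lp_section big_seq; apply: bigmax_le => [|i iB]; first exact: ltW.
  rewrite leNgt; apply/negP => ei.
  suff /AB : i \in fset_set [set i | e <= `|a i : R|] by rewrite iB.
  by rewrite in_fset_set ?inE /= ?(ltW ei) //; exact: afin.
- move=> [M aM] _; rewrite /ell /=.
  have r0 : 0 < r by rewrite -lte_fin; exact: (lt_le_trans _ p1).
  apply: (@le_lt_trans _ _ (M `^ r)%:E); last exact: ltry.
  apply: esum_le_sum => A; rewrite -lp_section_powR //.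
  apply: ge0_ler_powR; rewrite ?nnegrE ?(ltW r0) ?lp_section_ge0 //.
    exact: le_trans (lp_section_ge0 _ _ _) (aM A).
  exact: aM.
(* Half of [e] is used because the tail bound is not strict, whereas an entry of size at least [e]
   must contradict it. *)
- move=> _ av e e0; have e2 : 0 < e / 2 by rewrite divr_gt0.
  have [A hA] := av isT _ e2.
  apply: sub_finite_set (finite_fset A) => i /= ei; apply/negPn/negP => iA.
  have : lp_section +oo%E [fset i]%fset a <= e / 2 by apply: hA; rewrite fdisjointX1.
  rewrite lp_section_fset1 //.
  by move: ei e0; lra.
Qed.

(** Both sides are suprema over finite sections, up to an [r]-th root for finite [p]. The index [i0]
    makes the range of absolute values nonempty, so that [sup] is a genuine supremum at [+oo]. *)
Lemma ell_norm_lseq (p : \bar R) (p1 : (1 <= p)%E) (i0 : I) (x : lseq (lp_norm I p1) true) :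
  ell_norm p (x : I -> R) = `|x|.
Proof.
have := (ell_lseq p1 x).2 (lseq_valP x).
case: p p1 x => [r||] p1 x //; rewrite /ell /= => xfin; apply/eqP; rewrite eq_le.
- have r0 : 0 < r by rewrite -lte_fin; exact: (lt_le_trans _ p1).
  have xM A : \sum_(i <- A) `|x i : R| `^ r <=
      fine (\esum_(i in [set: I]) (`|x i : R| `^ r)%:E).
    rewrite -lee_fin fineK; first by apply: sum_le_esum => i; exact: powR_ge0.
    by rewrite ge0_fin_numE // esum_ge0 // => i _; rewrite lee_fin powR_ge0.
  have esum0 : 0 <= fine (\esum_(i in [set: I]) (`|x i : R| `^ r)%:E).
    exact: le_trans (sum_powR_ge0 _ _ _) (xM fset0).
  apply/andP; split; last first.
    apply: lnorm_le => A /=.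
    by apply: ge0_ler_powR; rewrite ?nnegrE ?invr_ge0 ?(ltW r0) ?sum_powR_ge0.
  rewrite -[leRHS](powRr1 (normr_ge0 x)) -(mulfV (lt0r_neq0 r0)) powRrM.
  apply: ge0_ler_powR; rewrite ?nnegrE ?invr_ge0 ?(ltW r0) ?powR_ge0 //.
  rewrite -lee_fin fineK; last first.
    by rewrite ge0_fin_numE // esum_ge0 // => i _; rewrite lee_fin powR_ge0.
  apply: esum_le_sum => A; rewrite -lp_section_powR //.
  apply: ge0_ler_powR; rewrite ?nnegrE ?(ltW r0) ?lp_section_ge0 //.
  exact: (snorm_le_lnorm x A).
- have hs : has_sup (range (fun i => `|x i : R|)).
    by split; [exists `|x i0 : R|, i0|exists `|x| => _ [i _ <-]; exact: coord_le_lnorm].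
  apply/andP; split.
    by apply: ge_sup; [exact: hs.1|move=> _ [i _ <-]; exact: coord_le_lnorm].
  apply: lnorm_le => A; apply: bigmax_le => [|i _].
    by apply: le_trans (normr_ge0 (x i0 : R)) _; apply: sup_upper_bound => //; exists i0.
  by apply: sup_upper_bound => //; exists i.
Qed.

End EllSpaces.

(** * Sums over multi-indices *)

Section Boxes.
Variables (R : realType) (d : nat).
Local Notation index := (multi_index d).

Definition bounded_index m (g : {ffun 'I_d -> 'I_m}) : index :=
  [ffun k => val (g k)].

(** Boxes are cofinal among the finite sets of multi-indices, and sums of products over them factor
    coordinatewise. *)
Definition box (m : nat) : {fset index} :=
  [fset bounded_index g | g in enum {: {ffun 'I_d -> 'I_m}}]%fset.

Lemma box_sum (F : 'I_d -> nat -> R) m :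
  \sum_(n <- box m) \prod_(k < d) F k (n k) = \prod_(k < d) \sum_(j < m) F k j.
Proof.
rewrite bigA_distr_bigA /= big_imfset /=; last first.
  move=> g h _ _ /ffunP gh; apply/ffunP => k; apply/val_inj.
  by have := gh k; rewrite !ffunE.
rewrite undup_id ?enum_uniq // big_enum /=; apply: eq_bigr => g _.
by apply: eq_bigr => k _; rewrite ffunE.
Qed.

Lemma in_box m (n : index) : (forall k, (n k < m)%N) -> n \in box m.
Proof.
move=> nm; apply/imfsetP; exists [ffun k => Ordinal (nm k)] => /=; first by rewrite mem_enum.
by apply/ffunP => k; rewrite !ffunE.
Qed.

Lemma subset_box (A : {fset index}) :
  exists m0, forall m, (m0 <= m)%N -> (A `<=` box m)%fset.
Proof.
exists (\max_(n <- A) \max_(k < d) n k).+1%N => m mm.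
apply/fsubsetP => n nA; apply: in_box => k; apply: leq_trans mm; rewrite ltnS.
apply: leq_trans (leq_bigmax_seq _ nA isT).
exact: (leq_bigmax (F := fun k => n k)).
Qed.

Lemma box_totally : box @ \oo --> totally.
Proof.
move=> P [A _ AP]; have [m0 h] := subset_box A.
by exists m0 => // m /= /h Am; exact: AP.
Qed.

End Boxes.

(** * Base-[L] expansions *)

Lemma digits_lt L d (n : 'I_d -> nat) :
  (forall k, n k < L)%N -> (\sum_(k < d) n k * L ^ k < L ^ d)%N.
Proof.
elim: d n => [|d IH] n nL; first by rewrite big_ord0.
rewrite big_ord_recr /= expnS; have := IH _ (fun k => nL (widen_ord (leqnSn d) k)).
set s := (\sum_(i < d) _)%N => sL.
by have := nL ord_max; nia.
Qed.

(** The lower digits contribute less than [L ^ d], so equal values have equal top digits, and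
    induction handles the rest. *)
Lemma digits_inj L d (n m : 'I_d -> nat) :
  (forall k, n k < L)%N -> (forall k, m k < L)%N ->
  (\sum_(k < d) n k * L ^ k = \sum_(k < d) m k * L ^ k)%N -> n =1 m.
Proof.
elim: d n m => [|d IH] n m nL mL; first by move=> _ [].
rewrite !big_ord_recr /=.
have := digits_lt (fun k => nL (widen_ord (leqnSn d) k)).
have := digits_lt (fun k => mL (widen_ord (leqnSn d) k)).
have := IH _ _ (fun k => nL (widen_ord (leqnSn d) k))
  (fun k => mL (widen_ord (leqnSn d) k)).
set s := (\sum_(i < d) n _ * _)%N; set t := (\sum_(i < d) m _ * _)%N => eq_lo tL sL e.
have eM : n ord_max = m ord_max by nia.
have eq_st : s = t by nia.
move=> k; have [kd|kd] := ltnP k d; last first.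
  suff -> : k = ord_max by [].
  by apply/val_inj/eqP; rewrite eqn_leq kd -ltnS ltn_ord.
by have := eq_lo eq_st (Ordinal kd); congr (n _ = m _); exact/val_inj.
Qed.

(** * The functions [phi], their expansions and the kernel *)

Section PowerSeries.
Variables (R : realType) (d : nat) (c : nat -> R).
Hypothesis c_gt0 : forall n, 0 < c n.
Hypothesis sqrt_c_summable : cvgn (series (fun n => Num.sqrt (c n))).
Local Notation index := (multi_index d).
Local Notation Q := (cube R d).
Implicit Types (a : index -> R) (x y : Q) (n : index).

(** This is the supremum of the absolute value of [phi c n] over the cube. *)
Definition weight n : R := \prod_(k < d) Num.sqrt (c (n k)).

Lemma weight_gt0 n : 0 < weight n.
Proof. by apply: prodr_gt0 => k _; rewrite sqrtr_gt0. Qed.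

(** A finite set lies in a box, over which the sum factors into [d] copies of one partial sum of the
    convergent series of [Num.sqrt (c j)]. *)
Lemma weight_summable : abs_summable weight.
Proof.
exists (limn (series (fun j => Num.sqrt (c j))) ^+ d) => A.
have [m0 /(_ m0 (leqnn _)) Am] := subset_box A.
apply: (@le_trans _ _ (\sum_(n <- box d m0) weight n)).
  apply: ler_sum_fset => [n|n nA _]; first exact/ltW/weight_gt0.
  by split; [exact: (fsubsetP Am)|rewrite gtr0_norm ?weight_gt0].
rewrite /weight (box_sum (fun _ j => Num.sqrt (c j))) -[d in _ ^+ d]card_ord -prodr_const.
apply: ler_prod => k _; rewrite sumr_ge0 //=.
rewrite -(big_mkord predT (fun j => Num.sqrt (c j))).
apply: (nondecreasing_cvgn_le _ sqrt_c_summable).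
apply/nondecreasing_seqP => j; rewrite /series /= big_nat_recr //=.
by rewrite lerDl sqrtr_ge0.
Qed.

Lemma phi_le x n : `|phi c n x| <= weight n.
Proof.
rewrite normr_prod; apply: ler_prod => k _; rewrite normr_ge0 /= normrM normrX.
rewrite ger0_norm ?sqrtr_ge0 // -[leRHS]mulr1 ler_wpM2l ?sqrtr_ge0 //.
have /set_mem/(_ k)/= xk := valP x.
by rewrite exprn_ile1 // ler_norml; move: xk => /andP[/ltW-> /ltW->].
Qed.

Lemma phi_summable x : abs_summable (fun n => phi c n x).
Proof.
apply: abs_summable_le weight_summable => n.
by rewrite (gtr0_norm (weight_gt0 n)) phi_le.
Qed.

Lemma expansion_term_le a M x n : (forall n, `|a n| <= M) ->
  `|a n * phi c n x| <= M * weight n.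
Proof. by move=> aM; rewrite normrM ler_pM ?phi_le. Qed.

Lemma expansion_summable a M x : (forall n, `|a n| <= M) ->
  abs_summable (fun n => a n * phi c n x).
Proof.
move=> aM; apply: abs_summable_le (abs_summableZ M weight_summable) => n.
apply: le_trans (expansion_term_le x n aM) _; exact: ler_norm.
Qed.

Lemma expansion_usum a M : (forall n, `|a n| <= M) ->
  expansion c a (fun x => usum (fun n => a n * phi c n x)).
Proof. by move=> aM x; apply: usum_cvg; exact: expansion_summable aM. Qed.

Lemma phi_continuous n : continuous (phi c n : Q -> R).
Proof.
move=> x; rewrite /continuous_at /phi; have FF : Filter (nbhs x) by exact: nbhs_filter.
apply: (@cvg_big R _ *%R 1 predT (@mul_continuous R) _ _ _ _
  (fun k => Num.sqrt (c (n k)) * val x ord0 k ^+ n k)) => k _.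
apply: cvgMr; apply: (@continuous_comp _ _ _ (fun x : Q => val x ord0 k) (fun t => t ^+ n k)).
  apply: (@continuous_comp _ _ _ (fun x : Q => val x) (fun v : 'rV[R]_d => v ord0 k)).
    exact: initial_continuous.
  exact: coord_continuous.
exact: exprn_continuous.
Qed.

(** The tails are dominated by [M * weight n] independently of the point, so [f] is a uniform limit
    of the continuous finite sums [S]. *)
Lemma expansion_continuous a M (f : Q -> R) : (forall n, `|a n| <= M) ->
  expansion c a f -> continuous f.
Proof.
move=> aM af.
have M0 : 0 <= M by apply: le_trans (normr_ge0 (a [ffun=> 0%N])) _.
have fE x : f x = usum (fun n => a n * phi c n x) by exact/esym/usum_unique.
move=> x; have FF : Filter (nbhs x) by exact: nbhs_filter.
apply/cvgrPdist_le => e e0.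
have e3 : 0 < e / 3 by rewrite divr_gt0.
have [A hA] := abs_summable_tail (abs_summableZ M weight_summable) e3.
pose S y := \sum_(n <- A) a n * phi c n y.
have fS y : `|f y - S y| <= e / 3.
  rewrite fE; apply: usum_dist; first exact: expansion_summable aM.
  move=> B /hA; apply: le_trans; apply: le_trans (ler_norm_sum _ _ _) _.
  apply: ler_sum => n _; apply: le_trans (expansion_term_le y n aM) _.
  exact: ler_norm.
have : continuous S.
  move=> z; rewrite /continuous_at /S; have GG : Filter (nbhs z) by exact: nbhs_filter.
  apply: (@cvg_big R _ +%R 0 predT (@add_continuous R) _ _ _ _
    (fun n => a n * phi c n z)) => n _.
  by apply: cvgMr; exact: phi_continuous.
move=> /(_ x)/cvgrPdist_le/(_ _ e3); apply: filterS => y Sxy.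
have -> : f x - f y = (f x - S x) + (S x - S y) - (f y - S y) by ring.
apply: le_trans (ler_normB _ _) _; apply: le_trans (lerD (ler_normD _ _) (lexx _)) _.
by move: (fS x) (fS y) Sxy; lra.
Qed.

(** Absolute summability allows summing along boxes, where the partial sum is a product over [k] of
    partial sums of the series of [eta]; each factor converges since the product of two coordinates
    stays in the open unit interval. *)
Lemma phi_kernel_cvg (eta : R -> R) x y :
  (forall z, `|z| < 1 -> series (fun j => c j * z ^+ j) @ \oo --> eta z) ->
  usum (fun n => phi c n x * phi c n y) =
    \prod_(k < d) eta (val x ord0 k * val y ord0 k).
Proof.
move=> etaP; set f := fun n => _.
have sf : abs_summable f.
  by have [M xM] := abs_summable_bounded (phi_summable x); exact: expansion_summable xM.
have h : partial_sum f (box d m) @[m --> \oo] --> usum f.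
  exact: (cvg_comp _ _ (@box_totally d) (usum_cvg sf)).
have E m : partial_sum f (box d m) = \prod_(k < d)
    series (fun j => c j * (val x ord0 k * val y ord0 k) ^+ j) m.
  rewrite partial_sumE.
  under [RHS]eq_bigr do rewrite /series /= big_mkord.
  rewrite -(box_sum (fun k j => c j * (val x ord0 k * val y ord0 k) ^+ j)).
  apply: eq_bigr => n _; rewrite /f /phi -big_split /=.
  apply: eq_bigr => k _; rewrite mulrACA -exprMn -expr2 sqr_sqrtr //.
  exact: ltW.
rewrite -(cvg_lim (@norm_hausdorff _ R) h); apply: cvg_lim => //; under eq_cvg do rewrite E.
apply: (@cvg_big R _ *%R 1 predT (@mul_continuous R) _ _ _ _
  (fun k => eta (val x ord0 k * val y ord0 k))) => k _; apply: etaP.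
have /set_mem/(_ k)/= xk := valP x; have /set_mem/(_ k)/= yk := valP y.
by rewrite normrM mulr_ilt1 // ltr_norml.
Qed.

End PowerSeries.

(** * Uniqueness of the coefficients *)

Section Uniqueness.
Variables (R : realType) (d : nat).
Local Notation index := (multi_index d).
Implicit Types (a : index -> R) (n : index).

(* The exponent of [t] in [phi c n x] along the curve [x_k = t ^+ (L ^ d + L ^ k)]:
   the total degree dominates, and base-[L] digits break ties. *)
Definition curve_order (L : nat) n : nat := \sum_(k < d) n k * (L ^ d + L ^ k).

(** Among the multi-indices with nonzero coefficient take one of least [curve_order]. It has least
    total degree [D], as has any competitor of the same order, and uniqueness of base-[L] digits
    rules such a competitor out. *)
Lemma curve_order_min a : (exists n, a n != 0) ->
  exists L n0, [/\ (0 < L)%N, a n0 != 0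
    & forall n, a n != 0 -> n != n0 -> (curve_order L n0 < curve_order L n)%N].
Proof.
move=> [m am]; pose degree n := (\sum_(k < d) n k)%N.
have degP : exists D, `[< exists n, a n != 0 /\ degree n = D >].
  by exists (degree m); apply/asboolP; exists m.
case: (ex_minnP degP) => D /asboolP[n1 [an1 dn1]] Dmin.
(* Entries of a multi-index of degree [D] are at most [D], hence are digits in base [L]. *)
pose L := D.+1.
have ordP : exists w, `[< exists n, a n != 0 /\ curve_order L n = w >].
  by exists (curve_order L m); apply/asboolP; exists m.
case: (ex_minnP ordP) => w /asboolP[n0 [an0 wn0]] wmin.
have ordE n : curve_order L n = (L ^ d * degree n + \sum_(k < d) n k * L ^ k)%N.
  rewrite /curve_order /degree big_distrr /= -big_split /=.
  by apply: eq_bigr => k _; rewrite mulnDr [(L ^ d * _)%N]mulnC.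
have degD n : a n != 0 -> (D <= degree n)%N.
  by move=> an; apply: Dmin; apply/asboolP; exists n.
have digit n : degree n = D -> forall k, (n k < L)%N.
  by move=> nD k; rewrite /L ltnS -nD /degree (bigD1 k) //= leq_addr.
(* Orders of degree [D] stay below [L ^ d * D.+1], which is a lower bound for the orders of all
   larger degrees. *)
have ord1 : (curve_order L n1 < L ^ d * D.+1)%N.
  by rewrite ordE dn1 mulnS addnC ltn_add2r; exact/digits_lt/digit.
have low n : a n != 0 -> (curve_order L n <= curve_order L n1)%N -> degree n = D.
  move=> an /leq_ltn_trans/(_ ord1); rewrite ordE => h.
  have := degD n an; have : (0 < L ^ d)%N by rewrite expn_gt0.
  nia.
have ord01 : (curve_order L n0 <= curve_order L n1)%N.
  by rewrite wn0; apply: wmin; apply/asboolP; exists n1.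
exists L, n0; split=> // n an nn0; rewrite ltnNge; apply/negP => h.
have n0D := low _ an0 ord01; have nD := low _ an (leq_trans h ord01).
move/eqP: nn0; apply; apply/ffunP; apply: (digits_inj (digit _ nD) (digit _ n0D)).
have : curve_order L n = curve_order L n0.
  apply/eqP; rewrite eqn_leq h /= wn0; apply: wmin; apply/asboolP; by exists n.
by rewrite !ordE nD n0D => /addnI.
Qed.

Variable c : nat -> R.
Hypothesis c_gt0 : forall j, 0 < c j.
Hypothesis sqrt_c_summable : cvgn (series (fun j => Num.sqrt (c j))).

Lemma curve_subproof L (t : R) : (0 < L)%N -> 0 < t < 1 ->
  cube R d (\row_k t ^+ (L ^ d + L ^ k)).
Proof.
move=> L0 /andP[t0 t1] k /=; rewrite mxE.
rewrite (lt_trans _ (exprn_gt0 _ t0)) ?ltrN10 //= exprn_ilt1 ?(ltW t0) //.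
by rewrite addn_eq0 !expn_eq0 (gtn_eqF L0).
Qed.

Definition curve L t (L0 : (0 < L)%N) (t01 : 0 < t < 1) : cube R d :=
  exist (fun v : 'rV[R]_d => v \in cube R d) _ (mem_set (curve_subproof L0 t01)).

Lemma phi_curve L t (L0 : (0 < L)%N) (t01 : 0 < t < 1) n :
  phi c n (curve L0 t01) = weight c n * t ^+ curve_order L n.
Proof.
rewrite /phi /weight /curve_order /= -prodrXr -big_split /=.
by apply: eq_bigr => k _; rewrite mxE -exprM mulnC.
Qed.

(** Along the curve the term at [n0] has size [q * t ^+ w] with [w] its order, while all others
    together are at most [M * W * t ^+ w.+1]. A zero sum forces [q <= M * W * t] for every [t] in
    the open unit interval, which fails for small [t]. *)
Lemma usum_phi_inj a M : (forall n, `|a n| <= M) ->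
  (forall x, usum (fun n => a n * phi c n x) = 0) -> forall n, a n = 0.
Proof.
move=> aM fa0 m; apply/eqP/negPn/negP => am.
have [L [n0 [L0 an0 hmin]]] := curve_order_min (ex_intro _ m am).
have M0 : 0 <= M by exact: le_trans (normr_ge0 (a m)) (aM m).
have [W hW] := weight_summable d c_gt0 sqrt_c_summable.
have W0 : 0 <= W by apply: le_trans (hW fset0); rewrite big_seq_fset0.
pose q := `|a n0| * weight c n0.
have q0 : 0 < q by rewrite mulr_gt0 ?normr_gt0 ?weight_gt0.
have small (t : R) : 0 < t < 1 -> q <= M * W * t.
  move=> t01; have t0 : 0 < t by case/andP: t01.
  have bnd n : `|a n * phi c n (curve L0 t01)| =
      `|a n| * weight c n * t ^+ curve_order L n.
    rewrite phi_curve !normrM mulrA (gtr0_norm (weight_gt0 c_gt0 n)).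
    by rewrite (ger0_norm (exprn_ge0 _ (ltW t0))).
  have : `|usum (fun n => a n * phi c n (curve L0 t01)) -
      \sum_(n <- [fset n0]%fset) a n * phi c n (curve L0 t01)| <=
      M * W * t ^+ (curve_order L n0).+1.
    apply: usum_dist => [|B n0B].
      exact: (expansion_summable c_gt0 sqrt_c_summable (curve L0 t01) aM).
    apply: le_trans (ler_norm_sum _ _ _) _.
    apply: (@le_trans _ _ (\sum_(n <- B) M * `|weight c n| * t ^+ (curve_order L n0).+1)).
      rewrite !big_seq; apply: ler_sum => n nB; rewrite bnd.
      rewrite (gtr0_norm (weight_gt0 c_gt0 n)).
      have Mw : 0 <= M * weight c n by rewrite mulr_ge0 // ltW // weight_gt0.
      have [->|an] := eqVneq (a n) 0.
        by rewrite normr0 !mul0r mulr_ge0 // exprn_ge0 // ltW.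
      apply: ler_pM; rewrite ?exprn_ge0 ?(ltW t0) //.
      - by rewrite mulr_ge0 // ltW // weight_gt0.
      - by rewrite ler_wpM2r // ltW // weight_gt0.
      - apply: ler_wiXn2l; rewrite ?(ltW t0) //; first exact/ltW/(andP t01).2.
        apply: hmin => //; apply: contraTneq nB => ->.
        by move: n0B; rewrite fdisjoint1X.
    rewrite -mulr_suml -mulr_sumr ler_wpM2r ?exprn_ge0 ?(ltW t0) //.
    by rewrite ler_wpM2l.
  rewrite fa0 big_seq_fset1 sub0r normrN bnd exprS mulrA.
  by rewrite ler_pM2r ?exprn_gt0.
have MW0 : 0 <= M * W by exact: mulr_ge0.
have MWq : 0 < 2 * (M * W + q) by lra.
(* This [t] gives [M * W * t < q]; adding [q] in the denominator keeps it positive and [t] below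
   [1]. *)
have t01 : 0 < q / (2 * (M * W + q)) < 1.
  by rewrite divr_gt0 //= ltr_pdivrMr // mul1r; lra.
have := small _ t01; rewrite mulrA ler_pdivlMr //.
by nra.
Qed.

End Uniqueness.

(** The sets with Borel preimage form a sigma-algebra containing the open intervals, which generate
    the Borel sets of the line. *)
Lemma continuous_L0 (R : realType) (X : topologicalType) (f : X -> R) :
  continuous f -> @L0 R X f.
Proof.
move=> /continuousP fo Y mY.
have {mY} : <<s @measurable_realfun.RGenOpens.G R >> Y.
  rewrite -[<<s _ >>]/((@measurable_realfun.RGenOpens.G R).-sigma.-measurable).
  by rewrite -measurable_realfun.RGenOpens.measurableE.
apply: (smallest_sub (X := [set Y | <<s @open X >> (f @^-1` Y)])).
  split => /=.
  - by rewrite preimage_set0; exact: sigma_algebra0.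
  - by move=> A mA; exact: (sigma_algebraCD mA).
  - by move=> A mA; rewrite preimage_bigcup; exact: sigma_algebra_bigcup.
by move=> _ [x [y ->]]; apply: sub_sigma_algebra; apply: fo; exact: interval_open.
Qed.

(** * The reproducing kernel Banach spaces *)

Section Evaluation.
Variables (R : realType) (d : nat) (c : nat -> R).
Hypothesis c_gt0 : forall j, 0 < c j.
Hypothesis sqrt_c_summable : cvgn (series (fun j => Num.sqrt (c j))).
Local Notation index := (multi_index d).
Local Notation Q := (cube R d).

Section Space.
Variables (N : section_norm R index) (vanish : bool).
Local Notation T := (lseq N vanish).
Implicit Types (a : T).

Definition evaluation a : Q -> R^o :=
  fun x => usum (fun n => a n * phi c n x).

Let summable a x : abs_summable (fun n => a n * phi c n x).
Proof. exact: (expansion_summable c_gt0 sqrt_c_summable x (coord_le_lnorm a)). Qed.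

Lemma evaluation_linear : linear evaluation.
Proof.
move=> k a b; apply/funext => x.
rewrite /evaluation -[RHS]/(k * usum _ + usum _) -usum_linear; try exact: summable.
by congr usum; apply/funext => n /=; rewrite mulrA -mulrDl.
Qed.

HB.instance Definition _ :=
  GRing.isLinear.Build R T (Q -> R^o) *:%R evaluation evaluation_linear.

Lemma evaluation_expansion a : expansion c a (evaluation a).
Proof. exact: (expansion_usum c_gt0 sqrt_c_summable (coord_le_lnorm a)). Qed.

Lemma evaluation_inj : injective evaluation.
Proof.
move=> a b /eqP; rewrite -subr_eq0 -(raddfB (evaluation : {linear T -> (Q -> R^o)})).
move=> /eqP ab; apply/eqP; rewrite -subr_eq0; apply/eqP/val_inj/funext => n.
apply: (usum_phi_inj c_gt0 sqrt_c_summable (coord_le_lnorm (a - b))) => x.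
exact: (congr1 (@^~ x) ab).
Qed.

Lemma evaluation_space : exists ev : {linear T -> (Q -> R^o)},
  (ev : T -> Q -> R) = evaluation /\ function_space ev.
Proof.
exists (evaluation : {linear T -> (Q -> R^o)}); split=> //; split.
  exact: evaluation_inj.
move=> _ [a _ <-]; suff : continuous (evaluation a : Q -> R) by exact: continuous_L0.
exact: (expansion_continuous c_gt0 sqrt_c_summable (coord_le_lnorm a) (@evaluation_expansion a)).
Qed.

(** Section norms are dominated by finite sums of absolute values, so an absolutely summable family
    lies in every one of these spaces, with vanishing tails. *)
Lemma phi_lseq x : (fun n => phi c n x : R^o) \in lseq_pred N vanish.
Proof.
have [M xM] := phi_summable c_gt0 sqrt_c_summable x.
apply/lseq_predP; split.
  by exists M => A; apply: le_trans (snorm_sum _ _ _) (xM A).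
move=> _ e /(abs_summable_tail (phi_summable c_gt0 sqrt_c_summable x))[A hA].
by exists A => B /hA; apply: le_trans; exact: snorm_sum.
Qed.

Definition phi_seq x : T := Lseq (phi_lseq x).

End Space.

Variables (K : Q -> Q -> R) (eta : R -> R).
Hypothesis eta_cvg :
  forall z, `|z| < 1 -> series (fun j => c j * z ^+ j) @ \oo --> eta z.
Hypothesis K_eta :
  forall x y, K x y = \prod_(k < d) eta (val x ord0 k * val y ord0 k).

Lemma evaluation_phi_seq N vanish x : evaluation (phi_seq N vanish x) = K x.
Proof.
apply/funext => y; rewrite K_eta.
exact: (phi_kernel_cvg c_gt0 sqrt_c_summable x y eta_cvg).
Qed.

Lemma kernel_sym x y : K x y = K y x.
Proof. by rewrite !K_eta; apply: eq_bigr => k _; rewrite mulrC. Qed.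

(** The dual is realized by all families of finite conjugate norm, without a tail condition: at
    [p = 1] these are all bounded families. The family [phi_seq] lies on both sides, and pairing
    with it is evaluation at a point. *)
Lemma BK_rkbs (p : \bar R) : (1 <= p)%E ->
  exists (B : completeNormedModType R) (ev : {linear B -> (Q -> R^o)}),
    is_BK c p ev /\ two_sided_rkbs ev K.
Proof.
move=> p1; have [q pq] := conjugate_exists p1.
have q1 : (1 <= q)%E by exact: conjugate_ge1 pq.
pose N := lp_norm index p1; pose N' := lp_norm index q1.
have [ev [evE evF]] := evaluation_space N true.
have [ev' [evE' evF']] := evaluation_space N' false.
have [Phi [Phi_dual PhiE]] := @lseq_dual _ _ N N'
  (fun A a b => lp_hoelder A a b pq) (fun A b => lp_attained A b pq).
exists (lseq N true), ev; split; last first.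
  exists (lseq N' false), ev', Phi; split=> //; split.
  - by move=> x; exists (phi_seq N' false x) => //; rewrite evE' evaluation_phi_seq.
  (* The identity is required of every [g] representing [K x]; injectivity of the evaluation makes
     it [phi_seq]. *)
  - move=> x g f; rewrite evE' -(evaluation_phi_seq N' false) => /evaluation_inj ->.
    by rewrite PhiE evE.
  - move=> y; exists (phi_seq N true y) => //.
    by rewrite evE evaluation_phi_seq; apply/funext => x; exact: kernel_sym.
  - move=> y f g; rewrite evE (_ : K ^~ y = K y); last first.
      by apply/funext => x; exact: kernel_sym.
    rewrite -(evaluation_phi_seq N true) => /evaluation_inj ->.
    by rewrite PhiE evE'; congr usum; apply/funext => n; exact: mulrC.
split; first by case: evF.
- apply/seteqP; split=> f.
    move=> [a _ <-]; exists a; first exact/ell_lseq/lseq_valP.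
    by rewrite evE; exact: evaluation_expansion.
  move=> [a /(ell_lseq p1) aN af]; exists (Lseq aN) => //.
  by rewrite evE; apply/funext => x; apply: usum_unique; exact: af.
- move=> a b /(ell_lseq p1) bN; rewrite evE => bf.
  (* Uniqueness of the coefficients makes the norm independent of the chosen expansion. *)
  have -> : a = Lseq bN.
    apply: evaluation_inj; apply/funext => x; apply/esym/usum_unique; exact: bf.
  by rewrite -(ell_norm_lseq ([ffun=> 0%N] : index) (Lseq bN : lseq N true)).
Qed.

Lemma BK_continuous (p : \bar R) : (1 <= p)%E ->
  BK c p `<=` [set f : Q -> R | continuous f].
Proof.
move=> p1 f [a /(ell_lseq p1) aN af].
exact: (expansion_continuous c_gt0 sqrt_c_summable (coord_le_lnorm (Lseq aN)) af).
Qed.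

End Evaluation.

Theorem corollary4p15 (R : realType) (d : nat) (c : nat -> R)
    (K : cube R d -> cube R d -> R)
    (d_gt0 : (0 < d)%N)
    (hK : nonlinear_power_series_kernel c K)
    (hc : cvgn (series (fun n => Num.sqrt (c n)))) :
  [/\ exists (B : completeNormedModType R)
             (ev : {linear B -> (cube R d -> R^o)}),
        is_BK c 1%E ev /\ right_sided_rkbs ev K,
      forall p : \bar R, (1 < p)%E ->
        exists (B : completeNormedModType R)
               (ev : {linear B -> (cube R d -> R^o)}),
          is_BK c p ev /\ two_sided_rkbs ev K
    & forall p : \bar R, (1 <= p)%E ->
        BK c p `<=` [set f : cube R d -> R | continuous f]].
Proof.
have [c_gt0 [eta [eta_cvg K_eta]]] := hK; split=> [|p /ltW p1|p p1].
(* At [p = 1] only the right-sided half of the two-sided structure is kept. *)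
- have [B [ev [BKp [F [evF [Phi [? ? ? ? _]]]]]]] :=
    BK_rkbs c_gt0 hc eta_cvg K_eta (lexx 1%E).
  by exists B, ev; split=> //; exists F, evF, Phi.
- exact: (BK_rkbs c_gt0 hc eta_cvg K_eta p1).
- exact: (BK_continuous c_gt0 hc p1).
Qed.
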